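(* If $\varphi:\mathcal A\to M_m(\mathbb C)$ is a unital completely isometric linear map, then $n\le m$ and there are a unitary $U\in M_m(\mathbb C)$, a positive integer $\ell$, and a unital completely contractive linear map $\psi:\mathcal A\to M_{m-\ell n}(\mathbb C)$ such that $$\varphi(X)=U\big((X\otimes I_\ell)\oplus\psi(X)\big)U^*\quad\text{for every }X\in\mathcal A,$$ where $X\otimes I_\ell$ denotes the direct sum of $\ell$ copies of $X$.
   Context: $S$ denotes the $n\times n$ nilpotent Jordan block with ones on the superdiagonal and zeros elsewhere. $\mathcal A=\{f(S): f\text{ a complex polynomial}\}$ is the algebra of $n\times n$ upper-triangular Toeplitz matrices. Matrix algebras carry the operator norm induced by the Euclidean norm; unital means $\varphi(I)=I$. For a linear map $\varphi$ and $k\in\mathbb N$, $\varphi^{(k)}=\varphi\otimes\mathrm{id}_{M_k}$ applies $\varphi$ entrywise to $k\times k$ block matrices; $\varphi$ is completely isometric (resp. completely contractive) if every $\varphi^{(k)}$ is an isometry (resp. a contraction) for the operator norms. *)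

(* Defs.v *)
From HB Require Import structures.
From mathcomp Require Import all_boot all_order all_algebra.
Set Implicit Arguments. Unset Strict Implicit. Unset Printing Implicit Defensive.
Import Order.TTheory GRing.Theory Num.Theory.
Local Open Scope ring_scope.

Section Defs.
Variable C : numClosedFieldType.

(* The n x n nilpotent Jordan block: ones on the superdiagonal. *)
Definition jordanS (n : nat) : 'M[C]_n :=
  \matrix_(i < n, j < n) ((j : nat) == i.+1)%:R.

(* S^i (iterated matrix product; works for every n, including n = 0). *)
Definition Spow (n i : nat) : 'M[C]_n := iter i (mulmx (jordanS n)) 1%:M.

(* Membership in the algebra A = { f(S) : f a complex polynomial }. *)
Definition inToeplitz (n : nat) (X : 'M[C]_n) : Prop :=
  exists p : {poly C}, X = \sum_(i < size p) p`_i *: Spow n i.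

(* Conjugate transpose. *)
Definition adjmx (p q : nat) (U : 'M[C]_(p, q)) : 'M[C]_(q, p) :=
  (map_mx (fun x => x^*) U)^T.

(* Squared Euclidean norm of a column vector. *)
Definition vnorm2 (q : nat) (v : 'cV[C]_q) : C := \sum_(i < q) `|v i 0| ^+ 2.

(* ||A|| <= c for the operator norm induced by the Euclidean norm, i.e.
   ||A v|| <= c ||v|| for all v (stated with squares), c >= 0. *)
Definition opnorm_le (p q : nat) (A : 'M[C]_(p, q)) (c : C) : Prop :=
  forall v : 'cV[C]_q, vnorm2 (A *m v) <= c ^+ 2 * vnorm2 v.

(* Decomposition of a block index of a (k*n)-square matrix into
   (block index, index inside the block). *)
Definition bidx (k n : nat) (i : 'I_(k * n)) : 'I_k * 'I_n :=
  enum_val (cast_ord (esym (mxvec_cast k n)) i).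

(* The (k n) x (k n) matrix with k x k blocks B a b of size n x n. *)
Definition blockmx (k n : nat) (B : 'I_k -> 'I_k -> 'M[C]_n) : 'M[C]_(k * n) :=
  \matrix_(i, j) B (bidx i).1 (bidx j).1 (bidx i).2 (bidx j).2.

(* phi^(k) applied to the block matrix [B a b]. *)
Definition ampl (n m k : nat) (phi : 'M[C]_n -> 'M[C]_m)
  (B : 'I_k -> 'I_k -> 'M[C]_n) : 'M[C]_(k * m) :=
  blockmx (fun a b => phi (B a b)).

(* X (x) I_l : the direct sum of l copies of X. *)
Definition copies (n l : nat) (X : 'M[C]_n) : 'M[C]_(l * n) :=
  blockmx (fun a b : 'I_l => if a == b then X else 0).

(* phi is completely isometric on A: for every k, phi^(k) preserves the
   operator norm of every k x k block matrix with entries in A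
   (equality of norms expressed as: same bounds c >= 0). *)
Definition complete_isometry_on_A (n m : nat) (phi : 'M[C]_n -> 'M[C]_m) : Prop :=
  forall (k : nat) (B : 'I_k -> 'I_k -> 'M[C]_n),
    (forall a b, inToeplitz (B a b)) ->
    forall c : C, 0 <= c ->
      (opnorm_le (ampl phi B) c <-> opnorm_le (blockmx B) c).

(* phi is completely contractive on A. *)
Definition complete_contraction_on_A (n m : nat) (phi : 'M[C]_n -> 'M[C]_m) : Prop :=
  forall (k : nat) (B : 'I_k -> 'I_k -> 'M[C]_n),
    (forall a b, inToeplitz (B a b)) ->
    forall c : C, 0 <= c ->
      opnorm_le (blockmx B) c -> opnorm_le (ampl phi B) c.

End Defs.

(* Main.v *)
Require Import Defs.
From HB Require Import structures.
From mathcomp Require Import all_boot all_order all_algebra.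
From mathcomp Require Import ring zify.
Import Order.TTheory GRing.Theory Num.Theory.
Local Open Scope ring_scope.

(* It suffices to take l = 1: one looks for an isometry V with phi(X) V = V X
   and phi(X)^* V = V X^* for X in A, since the range of V then reduces phi(A)
   and psi is the compression of phi to its orthogonal complement.
   A unital complete isometry preserves and reflects positivity of the real part
   of block matrices over A.  On block vectors f_0, ..., f_(n-1) the form
     Q(f) = sum_c |f_c|^2 + |f_(c+1)|^2 - 2 Re <S f_(c+1), f_c>
   is nonnegative and, up to scalars, vanishes only at the standard basis of C^n.
   Hence its image under phi has a nonzero null vector eta: were that image
   coercive, Q would be coercive too.  If f_b |-> R f, with coefficients in A + A^*,
   vanishes on the null space of Q, then |u|^2 + 2 Re <R f, u> + K Q(f) >= 0 for some
   K, and applying phi to this form, at (f, u) = (eta, - R_phi eta), shows that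
   R_phi eta = 0.  Thus eta satisfies every such linear relation of the standard
   basis; these say that the matrix V with columns eta_b intertwines as required,
   and V^* V commutes with S and S^*, hence is a scalar. *)

(** * Euclidean norms and Hermitian forms *)

Section InnerProduct.
Context {C : numClosedFieldType}.

Lemma adjmxK p q (A : 'M[C]_(p, q)) : adjmx (adjmx A) = A.
Proof. by apply/matrixP=> i j; rewrite !mxE conjCK. Qed.

Lemma adjmxM p q r (A : 'M[C]_(p, q)) (B : 'M[C]_(q, r)) :
  adjmx (A *m B) = adjmx B *m adjmx A.
Proof. by rewrite /adjmx map_mxM trmx_mul. Qed.

Lemma adjmxD p q (A B : 'M[C]_(p, q)) : adjmx (A + B) = adjmx A + adjmx B.
Proof. by rewrite /adjmx map_mxD linearD. Qed.

Lemma adjmxZ p q a (A : 'M[C]_(p, q)) : adjmx (a *: A) = a^* *: adjmx A.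
Proof. by rewrite /adjmx map_mxZ linearZ. Qed.

Lemma adjmx0 p q : adjmx (0 : 'M[C]_(p, q)) = 0.
Proof. by rewrite /adjmx map_mx0 trmx0. Qed.

Lemma adjmx1 p : adjmx (1%:M : 'M[C]_p) = 1%:M.
Proof. by rewrite /adjmx map_mx1 trmx1. Qed.

Lemma ge0_eq (x y : C) : x = y -> 0 <= x -> 0 <= y.
Proof. by move=> ->. Qed.

Definition ip q (u v : 'cV[C]_q) : C := (adjmx v *m u) 0 0.

Lemma ipE q (u v : 'cV[C]_q) : ip q u v = \sum_i u i 0 * (v i 0)^*.
Proof. by rewrite /ip mxE; apply: eq_bigr => i _; rewrite !mxE mulrC. Qed.

Lemma ip_conj q (u v : 'cV[C]_q) : (ip q u v)^* = ip q v u.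
Proof.
by rewrite !ipE rmorph_sum; apply: eq_bigr => i _; rewrite rmorphM /= conjCK mulrC.
Qed.

Lemma ipDl q (u v w : 'cV[C]_q) : ip q (u + v) w = ip q u w + ip q v w.
Proof. by rewrite /ip mulmxDr mxE. Qed.

Lemma ipZl q a (u w : 'cV[C]_q) : ip q (a *: u) w = a * ip q u w.
Proof. by rewrite /ip -scalemxAr mxE. Qed.

Lemma ipDr q (u v w : 'cV[C]_q) : ip q w (u + v) = ip q w u + ip q w v.
Proof. by rewrite /ip adjmxD mulmxDl mxE. Qed.

Lemma ipZr q a (u w : 'cV[C]_q) : ip q w (a *: u) = a^* * ip q w u.
Proof. by rewrite /ip adjmxZ -scalemxAl mxE. Qed.

Lemma ip0l q (w : 'cV[C]_q) : ip q 0 w = 0.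
Proof. by rewrite /ip mulmx0 mxE. Qed.

Lemma ip0r q (w : 'cV[C]_q) : ip q w 0 = 0.
Proof. by rewrite -ip_conj ip0l rmorph0. Qed.

Lemma ip_suml q (I : finType) (F : I -> 'cV[C]_q) w :
  ip q (\sum_i F i) w = \sum_i ip q (F i) w.
Proof. by rewrite /ip mulmx_sumr summxE. Qed.

Lemma ip_adjr p q (A : 'M[C]_(p, q)) u v :
  ip p (A *m u) v = ip q u (adjmx A *m v).
Proof. by rewrite /ip adjmxM adjmxK mulmxA. Qed.

Lemma vnorm2E q (v : 'cV[C]_q) : vnorm2 v = ip q v v.
Proof. by rewrite ipE; apply: eq_bigr => i _; rewrite normCK. Qed.

Lemma vnorm2_ge0 q (v : 'cV[C]_q) : 0 <= vnorm2 v.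
Proof. by apply: sumr_ge0 => i _; rewrite exprn_ge0. Qed.

Lemma vnorm2_eq0 q (v : 'cV[C]_q) : vnorm2 v = 0 -> v = 0.
Proof.
move=> v0; apply/colP=> i; rewrite mxE; apply/eqP.
rewrite -normr_eq0 -sqrf_eq0; apply/eqP; apply: (psumr_eq0P _ v0) => // k _.
by rewrite exprn_ge0.
Qed.

Lemma vnorm20 q : vnorm2 (0 : 'cV[C]_q) = 0.
Proof. by rewrite vnorm2E ip0l. Qed.

Lemma vnorm2Z q a (v : 'cV[C]_q) : vnorm2 (a *: v) = `|a| ^+ 2 * vnorm2 v.
Proof. by rewrite !vnorm2E ipZl ipZr mulrA -normCK. Qed.

Lemma vnorm2D q (u v : 'cV[C]_q) :
  vnorm2 (u + v) = vnorm2 u + vnorm2 v + (ip q u v + (ip q u v)^*).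
Proof. rewrite !vnorm2E ip_conj !ipDl !ipDr; ring. Qed.

Lemma vnorm2_isometry p q (V : 'M[C]_(p, q)) v :
  adjmx V *m V = 1%:M -> vnorm2 (V *m v) = vnorm2 v.
Proof. by move=> VV; rewrite !vnorm2E ip_adjr mulmxA VV mul1mx. Qed.

(** Expand 0 <= |v - V V^* v|^2 = |v|^2 - |V^* v|^2. *)
Lemma vnorm2_coisometry p q (V : 'M[C]_(p, q)) v :
  adjmx V *m V = 1%:M -> vnorm2 (adjmx V *m v) <= vnorm2 v.
Proof.
move=> VV; set w := adjmx V *m v.
have e : ip _ v (V *m w) = vnorm2 w.
  by rewrite -ip_conj ip_adjr ip_conj vnorm2E.
have := vnorm2_ge0 _ (v + (-1) *: (V *m w)).
rewrite vnorm2D vnorm2Z (vnorm2_isometry _ _ _ _ VV) ipZr e rmorphN1.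
rewrite rmorphM /= rmorphN1 geC0_conj ?vnorm2_ge0 // normrN1 expr1n mul1r.
rewrite -[_ <= vnorm2 v]subr_ge0; apply: ge0_eq; ring.
Qed.

(** A crude bound is enough: scaled matrix units are bounded, and bounded matrices are closed under
    addition because |x + y|^2 <= 2 (|x|^2 + |y|^2). *)
Lemma vnorm2_bounded p q (A : 'M[C]_(p, q)) :
  exists2 K : C, 0 <= K & forall v, vnorm2 (A *m v) <= K * vnorm2 v.
Proof.
pose P (B : 'M[C]_(p, q)) :=
  exists2 K : C, 0 <= K & forall v, vnorm2 (B *m v) <= K * vnorm2 v.
have P0 : P 0 by exists 0 => // v; rewrite mul0mx vnorm20 mul0r.
have PD B B' : P B -> P B' -> P (B + B').
  case=> K K0 HK [K' K'0 HK']; exists (2 * (K + K')).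
    by rewrite mulr_ge0 ?addr_ge0.
  move=> v; rewrite mulmxDl; set x := B *m v; set y := B' *m v.
  have xy : vnorm2 (x + y) <= 2 * (vnorm2 x + vnorm2 y).
    have := vnorm2_ge0 _ (x + (-1) *: y).
    rewrite -[vnorm2 _ <= _]subr_ge0 2!vnorm2D vnorm2Z normrN1.
    rewrite expr1n mul1r ipZr rmorphN1 rmorphM rmorphN1; apply: ge0_eq; ring.
  apply: le_trans xy _; rewrite -mulrA ler_pM2l ?ltr0n // mulrDl.
  exact: lerD (HK v) (HK' v).
rewrite [A]matrix_sum_delta; apply: (big_ind P) => // i _.
apply: (big_ind P) => // j _; exists (`|A i j| ^+ 2); first by rewrite exprn_ge0.
move=> v; rewrite -scalemxAl vnorm2Z ler_wpM2l ?exprn_ge0 //.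
have ->: vnorm2 (delta_mx i j *m v) = `|v j 0| ^+ 2.
  rewrite /vnorm2 (bigD1 i) //= big1 ?addr0.
    rewrite mxE (bigD1 j) //= big1 ?addr0 ?mxE ?eqxx ?mul1r //.
    by move=> k /negPf kj; rewrite mxE kj andbF mul0r.
  move=> k /negPf ki; rewrite mxE big1 ?normr0 ?expr0n // => l _.
  by rewrite mxE ki mul0r.
rewrite /vnorm2 (bigD1 j) //= lerDl; apply: sumr_ge0 => k _.
by rewrite exprn_ge0.
Qed.

End InnerProduct.
Arguments ip {C q}.

Section HermitianForm.
Context {C : numClosedFieldType}.

(** Twice the real part of <M v, v>, that is, the quadratic form of the Hermitian matrix M + M^*. *)
Definition hform p (M : 'M[C]_p) (v : 'cV[C]_p) : C :=
  ip (M *m v) v + (ip (M *m v) v)^*.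

Lemma hform_real p (M : 'M[C]_p) v : hform p M v \is Num.real.
Proof. by rewrite CrealE rmorphD /= conjCK addrC. Qed.

Lemma hformE p (M : 'M[C]_p) v : hform p M v = ip ((M + adjmx M) *m v) v.
Proof. by rewrite /hform ip_conj mulmxDl ipDl [ip (adjmx M *m v) v]ip_adjr adjmxK. Qed.

Lemma vnorm2_sub_scale p (M : 'M[C]_p) t v : 0 <= t ->
  vnorm2 ((1%:M - t *: M) *m v)
  = vnorm2 v - t * hform p M v + t ^+ 2 * vnorm2 (M *m v).
Proof.
move=> t0; have tc : t^* = t by apply/eqP; rewrite -CrealE ger0_real.
rewrite mulmxBl mul1mx -scalemxAl -scaleNr vnorm2D vnorm2Z normrN ger0_norm //.
rewrite ip_conj ipZl ipZr rmorphN /= tc /hform ip_conj; ring.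
Qed.

(* Re M >= 0 is equivalent to ||1 - tM||^2 <= 1 + O(t^2) for t > 0 small. *)
Lemma hform_ge0_transfer p q (M : 'M[C]_p) (N : 'M[C]_q) :
  (forall t c : C, 0 <= t -> 0 <= c ->
     opnorm_le (1%:M - t *: M) c -> opnorm_le (1%:M - t *: N) c) ->
  (forall v, 0 <= hform p M v) -> forall w, 0 <= hform q N w.
Proof.
move=> MN M0 w; have [K K0 HK] := vnorm2_bounded _ _ M.
have key t : 0 < t -> - (t * (K * vnorm2 w)) <= hform q N w.
  move=> t0; have tg := ltW t0.
  have c20 : 0 <= 1 + t ^+ 2 * K by rewrite addr_ge0 // mulr_ge0 // exprn_ge0.
  have := MN t (sqrtC (1 + t ^+ 2 * K)) tg.
  rewrite sqrtC_ge0 => /(_ c20); rewrite /opnorm_le sqrtCK.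
  have HM v : vnorm2 ((1%:M - t *: M) *m v) <= (1 + t ^+ 2 * K) * vnorm2 v.
    rewrite vnorm2_sub_scale // mulrDl mul1r lerD //.
      by rewrite gerBl mulr_ge0.
    by rewrite -mulrA ler_wpM2l ?exprn_ge0.
  move=> /(_ HM w).
  rewrite vnorm2_sub_scale // mulrDl mul1r -addrA lerD2l => le.
  rewrite -(ler_pM2l t0) -subr_ge0.
  have le' : 0 <= t ^+ 2 * vnorm2 (N *m w).
    by rewrite mulr_ge0 ?exprn_ge0 ?vnorm2_ge0.
  rewrite -subr_ge0 in le; apply: le_trans (addr_ge0 le le') _.
  by rewrite le_eqVlt; apply/orP; left; apply/eqP; ring.
(* [C] is only partially ordered; [hform] is comparable with 0 because it is real. *)
have [//|neg] := real_leP (real0 C) (hform_real q N w).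
set A := K * vnorm2 w in key.
have A0 : 0 <= A by rewrite mulr_ge0 ?vnorm2_ge0.
have A1 : 0 < A + 1 by rewrite ltr_wpDl.
have s0 : 0 < - hform q N w by rewrite oppr_gt0.
(* The choice t = - hform N w / (A + 1) turns [key] into A + 1 <= A. *)
have /key := divr_gt0 s0 A1.
rewrite lerNl mulrAC ler_pdivlMr // ler_pM2l // -subr_ge0.
have ->: A - (A + 1) = -1 by ring.
by rewrite oppr_ge0 ler10.
Qed.

(** As R kills the null space of H = M + M^*, it factors as D H, and it remains to bound |H v|^2 by
    a multiple of <H v, v>. No square root of H is taken: positivity of H at L v - y, with y = H v
    and <H y, y> <= L |y|^2, gives |y|^2 <= L <H v, v>. *)
Lemma hform_kernel_bound p q (M : 'M[C]_p) (R : 'M[C]_(q, p)) :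
  (forall v, 0 <= hform p M v) ->
  (forall v : 'cV[C]_p, (M + adjmx M) *m v = 0 -> R *m v = 0) ->
  exists2 K : C, 0 <= K & forall v, vnorm2 (R *m v) <= K * hform p M v.
Proof.
set H := M + adjmx M => M0 kerHR.
have HH : adjmx H = H by rewrite /H adjmxD adjmxK addrC.
have /submxP[D ->] : (R <= H)%MS.
  rewrite submxE; apply/eqP/matrixP=> i j.
  have /colP/(_ i) : col j (R *m cokermx H) = 0.
    by rewrite colE -mulmxA kerHR // mulmxA mulmx_coker mul0mx.
  by rewrite !mxE.
have [K1 K10 HK1] := vnorm2_bounded _ _ D.
have [K K0 HK] := vnorm2_bounded _ _ H.
have L0 : 0 < 1 + K by rewrite ltr_pwDl.
exists (K1 * (1 + K)); first by rewrite mulr_ge0 // ltW.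
move=> v; rewrite -mulmxA; apply: le_trans (HK1 _) _; rewrite -mulrA ler_wpM2l //.
set y := H *m v.
(* From |y - H y|^2 >= 0, |H y|^2 <= K |y|^2 and <H y, y> >= 0. *)
have yHy : ip (H *m y) y <= (1 + K) * vnorm2 y.
  have x0 := M0 y; rewrite hformE -/H in x0.
  have := vnorm2_ge0 _ (y + (-1) *: (H *m y)).
  rewrite vnorm2D vnorm2Z ipZr rmorphN1 rmorphM /= ip_conj rmorphN1.
  rewrite -[ip y (H *m y)]ip_conj geC0_conj // normrN1 expr1n mul1r => h.
  rewrite -subr_ge0; have h' := HK y; rewrite -subr_ge0 in h'.
  apply: ge0_eq (addr_ge0 (addr_ge0 h h') x0); ring.
have := M0 ((1 + K) *: v + (-1) *: y).
rewrite hformE -/H mulmxDr -!scalemxAr -/y !ipDl !ipDr !ipZl !ipZr.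
rewrite [ip (H *m y) v]ip_adjr HH -/y -vnorm2E rmorphN1 [_^*]geC0_conj ?(ltW L0) //.
rewrite -[hform p M v]/(_) hformE -/H -/y => h.
rewrite -subr_ge0 in yHy; have h' := addr_ge0 h yHy.
rewrite -subr_ge0 -(pmulr_rge0 _ L0); apply: ge0_eq h'; ring.
Qed.

(** If M + M^* has trivial null space, the preceding bound with R = 1 is coercivity; otherwise a
    nonzero column of its [cokermx] is a null vector. *)
Lemma psd_kernel_or_coercive p (M : 'M[C]_p) : (forall v, 0 <= hform p M v) ->
  (exists2 v : 'cV[C]_p, v != 0 & (M + adjmx M) *m v = 0) \/
  (exists2 K : C, 0 <= K & forall v, vnorm2 v <= K * hform p M v).
Proof.
move=> M0; set H := M + adjmx M.
case: (eqVneq (cokermx H) 0) => [k0 | kn0]; [right | left].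
  case: (@hform_kernel_bound p p M 1%:M M0) => [v Hv0 | K K0 HK]; last first.
    by exists K => // v; have := HK v; rewrite mul1mx.
  have /submxP[D ->] : ((1%:M : 'M[C]_p) <= H)%MS by rewrite submxE k0 mulmx0.
  by rewrite -mulmxA Hv0 mulmx0.
have /existsP[j cj] : [exists j, col j (cokermx H) != 0].
  apply: contraR kn0; rewrite negb_exists => /forallP k0; apply/eqP/matrixP=> i j.
  by have := k0 j; rewrite negbK => /eqP/colP/(_ i); rewrite !mxE.
by exists (col j (cokermx H)) => //; rewrite colE mulmxA mulmx_coker mul0mx.
Qed.

End HermitianForm.
Arguments hform {C p}.

(** * Block matrices *)

Section BlockVectors.
Context {C : numClosedFieldType}.

Lemma bidxK k n : cancel (@bidx k n) (fun p => mxvec_index p.1 p.2).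
Proof.
by move=> i; rewrite /bidx /mxvec_index -surjective_pairing enum_valK cast_ordKV.
Qed.

Lemma mxvec_indexK k n (a : 'I_k) (i : 'I_n) : bidx (mxvec_index a i) = (a, i).
Proof. by rewrite /bidx /mxvec_index cast_ordK enum_rankK. Qed.

Lemma sum_bidx (V : nmodType) k n (F : 'I_k -> 'I_n -> V) :
  \sum_(i < k * n) F (bidx i).1 (bidx i).2 = \sum_a \sum_b F a b.
Proof.
rewrite pair_big /= (reindex (@bidx k n)) //.
exists (fun p => mxvec_index p.1 p.2) => [i _|[a b] _]; first exact: bidxK.
exact: mxvec_indexK.
Qed.

Definition glue k n (f : 'I_k -> 'cV[C]_n) : 'cV[C]_(k * n) :=
  \col_i f (bidx i).1 (bidx i).2 0.

Lemma glueP k n (v : 'cV[C]_(k * n)) : exists f, v = glue k n f.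
Proof.
exists (fun a => \col_i v (mxvec_index a i) 0); apply/colP=> i.
by rewrite !mxE bidxK.
Qed.

Lemma ip_glue k n (f g : 'I_k -> 'cV[C]_n) :
  ip (glue k n f) (glue k n g) = \sum_a ip (f a) (g a).
Proof.
rewrite ipE -[RHS](eq_bigr _ (fun a _ => esym (ipE _ _ _))).
rewrite -(sum_bidx _ _ _ (fun a i => f a i 0 * (g a i 0)^*)).
by apply: eq_bigr => i _; rewrite !mxE.
Qed.

Lemma vnorm2_glue k n (f : 'I_k -> 'cV[C]_n) :
  vnorm2 (glue k n f) = \sum_a vnorm2 (f a).
Proof. by rewrite vnorm2E ip_glue; apply: eq_bigr => a _; rewrite vnorm2E. Qed.

Lemma mul_blockmx k n (B : 'I_k -> 'I_k -> 'M[C]_n) f :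
  blockmx B *m glue k n f = glue k n (fun a => \sum_b B a b *m f b).
Proof.
apply/colP=> i; rewrite !mxE summxE.
transitivity (\sum_b \sum_j B (bidx i).1 b (bidx i).2 j * f b j 0); last first.
  by apply: eq_bigr => b _; rewrite mxE.
rewrite -(sum_bidx _ _ _ (fun b j => B (bidx i).1 b (bidx i).2 j * f b j 0)).
by apply: eq_bigr => j _; rewrite !mxE.
Qed.

Lemma ip_blockmx k n (B : 'I_k -> 'I_k -> 'M[C]_n) f :
  ip (blockmx B *m glue k n f) (glue k n f)
  = \sum_a \sum_b ip (B a b *m f b) (f a).
Proof. by rewrite mul_blockmx ip_glue; apply: eq_bigr => a _; rewrite ip_suml. Qed.

Lemma blockmx1 k n :
  blockmx (fun a b : 'I_k => (a == b)%:R *: 1%:M) = 1%:M :> 'M[C]_(k * n).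
Proof.
apply/matrixP=> i j; rewrite !mxE -natrM mulnb; congr (nat_of_bool _)%:R.
by rewrite -(can_eq (bidxK k n)) [bidx i]surjective_pairing [bidx j]surjective_pairing.
Qed.

Lemma blockmx_sub_scale k n t (A B : 'I_k -> 'I_k -> 'M[C]_n) :
  blockmx A - t *: blockmx B = blockmx (fun a b => A a b - t *: B a b).
Proof. by apply/matrixP=> i j; rewrite !mxE. Qed.

End BlockVectors.
Arguments glue {C k n}.

(** * The Toeplitz algebra *)

Section Toeplitz.
Context {C : numClosedFieldType}.
Implicit Type p : {poly C}.

(** Coefficients past the size vanish, so polynomials of different degrees can be padded to a common
    range before being added. *)
Lemma Toeplitz_sum_widen n p N : (size p <= N)%N ->
  \sum_(i < size p) p`_i *: Spow C n i = \sum_(i < N) p`_i *: Spow C n i.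
Proof.
move=> sN; rewrite (big_ord_widen N (fun i => p`_i *: Spow C n i) sN).
rewrite big_mkcond; apply: eq_bigr => i _; case: ltnP => // /(nth_default 0) ->.
by rewrite scale0r.
Qed.

Lemma inToeplitz_lin n a (X Y : 'M[C]_n) :
  inToeplitz X -> inToeplitz Y -> inToeplitz (a *: X + Y).
Proof.
move=> [p ->] [q ->]; exists (a *: p + q).
set N := maxn (size (a *: p + q)) (maxn (size p) (size q)).
rewrite (Toeplitz_sum_widen n p N) ?(Toeplitz_sum_widen n q N)
  ?(Toeplitz_sum_widen n (a *: p + q) N) ?leq_max ?leqnn ?orbT //.
rewrite scaler_sumr -big_split; apply: eq_bigr => i _ /=.
by rewrite coefD coefZ scalerDl scalerA.
Qed.

Lemma inToeplitz_Spow n i : inToeplitz (Spow C n i).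
Proof.
exists 'X^i; rewrite size_polyXn big_ord_recr /= big1 ?add0r.
  by rewrite coefXn eqxx scale1r.
by move=> j _; rewrite coefXn ltn_eqF ?scale0r.
Qed.

Lemma inToeplitz0 n : inToeplitz (0 : 'M[C]_n).
Proof. by exists 0; rewrite size_poly0 big_ord0. Qed.

Lemma inToeplitz1 n : inToeplitz (1%:M : 'M[C]_n).
Proof. exact: (inToeplitz_Spow n 0). Qed.

Lemma inToeplitzZ n a (X : 'M[C]_n) : inToeplitz X -> inToeplitz (a *: X).
Proof. by move=> X0; rewrite -[_ *: _]addr0; apply: inToeplitz_lin (inToeplitz0 n). Qed.

Lemma inToeplitzD n (X Y : 'M[C]_n) :
  inToeplitz X -> inToeplitz Y -> inToeplitz (X + Y).
Proof. by move=> X0 Y0; rewrite -[X]scale1r; apply: inToeplitz_lin. Qed.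

Lemma inToeplitzB n a (X Y : 'M[C]_n) :
  inToeplitz X -> inToeplitz Y -> inToeplitz (X - a *: Y).
Proof. by move=> X0 Y0; rewrite addrC -scaleNr; apply: inToeplitz_lin. Qed.

Lemma inToeplitz_sum n (I : finType) (F : I -> 'M[C]_n) :
  (forall i, inToeplitz (F i)) -> inToeplitz (\sum_i F i).
Proof.
move=> HF; apply: big_ind => //; [exact: inToeplitz0 | exact: inToeplitzD].
Qed.

Lemma SpowE n i (a b : 'I_n) : Spow C n i a b = ((b : nat) == a + i)%N%:R.
Proof.
elim: i a b => [|i IH] a b; first by rewrite /= mxE addn0 eq_sym.
rewrite /= mxE; have [lt | ge] := ltnP a.+1 n.
  rewrite (bigD1 (Ordinal lt)) //= big1 ?addr0 => [|c ca].
    by rewrite IH mxE eqxx mul1r addSnnS.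
  rewrite mxE; case: eqP => [e|]; last by rewrite mul0r.
  by case/eqP: ca; apply: val_inj.
rewrite big1 => [|c _]; last by rewrite mxE ltn_eqF ?mul0r // (leq_trans _ ge).
by rewrite ltn_eqF // (leq_trans (ltn_ord b)) // addnS (leq_trans ge) // ltnS leq_addr.
Qed.

End Toeplitz.

(** * Bordered block matrices *)

Section Bordered.
Context {C : numClosedFieldType}.

Lemma hformD p (M N : 'M[C]_p) v : hform (M + N) v = hform M v + hform N v.
Proof. rewrite /hform mulmxDl ipDl rmorphD /=; ring. Qed.

Lemma hformZ p a (M : 'M[C]_p) v : a \is Num.real -> hform (a *: M) v = a * hform M v.
Proof.
by move=> /CrealP ac; rewrite /hform -scalemxAl ipZl rmorphM /= ac mulrDr.
Qed.

Lemma hform1 p (v : 'cV[C]_p) : hform 1%:M v = 2 * vnorm2 v.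
Proof.
by rewrite /hform mul1mx -vnorm2E geC0_conj ?vnorm2_ge0 // mulr2n mulrDl mul1r.
Qed.

Lemma hform_ker p (M : 'M[C]_p) v : (M + adjmx M) *m v = 0 -> hform M v = 0.
Proof. by rewrite hformE => ->; rewrite ip0l. Qed.

Definition bordered k n (D : 'M[C]_n) (Y Z : 'I_k -> 'M[C]_n)
    (P : 'I_k -> 'I_k -> 'M[C]_n) (a b : 'I_k.+1) : 'M[C]_n :=
  match unlift ord0 a, unlift ord0 b with
  | None, None => D
  | None, Some b' => Y b'
  | Some a', None => Z a'
  | Some a', Some b' => P a' b'
  end.

(** The term <Z u, f> is the conjugate of <Z^* f, u>, so under the real part the border acts on f
    through Y + Z^*. This is how coefficients in A + A^* are reached with blocks from A alone. *)
Lemma hform_bordered k n (D : 'M[C]_n) (Y Z : 'I_k -> 'M[C]_n) P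
    (u : 'cV[C]_n) (f : 'I_k -> 'cV[C]_n) :
  let g a := oapp f u (unlift ord0 a) in
  let r := \sum_b (Y b + adjmx (Z b)) *m f b in
  hform (blockmx (bordered k n D Y Z P)) (glue g)
  = hform D u + hform (blockmx P) (glue f) + (ip r u + (ip r u)^*).
Proof.
move=> g r; rewrite /hform !ip_blockmx.
have -> : ip r u = \sum_b ip (Y b *m f b) u + \sum_b (ip (Z b *m u) (f b))^*.
  rewrite ip_suml -big_split; apply: eq_bigr => b _ /=.
  by rewrite mulmxDl ipDl ip_conj [ip (adjmx _ *m _) _]ip_adjr adjmxK.
have -> : \sum_a \sum_b ip (bordered k n D Y Z P a b *m g b) (g a)
    = (ip (D *m u) u + \sum_b ip (Y b *m f b) u)
      + \sum_a (ip (Z a *m u) (f a) + \sum_b ip (P a b *m f b) (f a)).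
  rewrite big_ord_recl; congr (_ + _).
    rewrite big_ord_recl /bordered /g unlift_none; congr (_ + _).
    by apply: eq_bigr => b _; rewrite liftK.
  apply: eq_bigr => a _; rewrite big_ord_recl /bordered /g unlift_none liftK.
  by congr (_ + _); apply: eq_bigr => b _; rewrite liftK.
rewrite big_split /= !rmorphD /= -(rmorph_sum _ _ _ (fun b => ip (Z b *m u) (f b))).
rewrite /= conjCK; ring.
Qed.

Definition block_row k n (W : 'I_k -> 'M[C]_n) : 'M[C]_(n, k * n) :=
  \matrix_(i, j) W (bidx j).1 i (bidx j).2.

Lemma mul_block_row k n (W : 'I_k -> 'M[C]_n) f :
  block_row k n W *m glue f = \sum_b W b *m f b.
Proof.
apply/colP=> i; rewrite mxE summxE.
transitivity (\sum_b \sum_j W b i j * f b j 0); last first.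
  by apply: eq_bigr => b _; rewrite mxE.
rewrite -(sum_bidx _ _ _ (fun b j => W b i j * f b j 0)).
by apply: eq_bigr => j _; rewrite !mxE.
Qed.

End Bordered.
Arguments bordered {C k n}.

(** * Transfer of positivity *)

Section CompleteIsometry.
Context {C : numClosedFieldType} (n m : nat) (phi : {linear 'M[C]_n -> 'M[C]_m}).
Hypothesis phi1 : phi 1%:M = 1%:M.
Hypothesis phi_iso : complete_isometry_on_A phi.

(** Positivity of Re B is read off the norms of 1 - t B. These matrices again have blocks in A, and
    [phi1] makes the amplification send them to 1 - t times the image of B, so the isometry gives
    both directions. *)
Lemma ampl_hform_ge0 k (B : 'I_k -> 'I_k -> 'M[C]_n) :
  (forall a b, inToeplitz (B a b)) ->
  (forall v, 0 <= hform (blockmx B) v) <-> (forall w, 0 <= hform (ampl phi B) w).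
Proof.
move=> BT.
have iso t c : 0 <= c -> opnorm_le (1%:M - t *: ampl phi B) c <->
    opnorm_le (1%:M - t *: blockmx B) c.
  move=> c0; rewrite -!blockmx1 /ampl !blockmx_sub_scale.
  have BT' a b : inToeplitz ((a == b)%:R *: 1%:M - t *: B a b).
    by apply: inToeplitzB => //; apply: inToeplitzZ; apply: inToeplitz1.
  rewrite (_ : blockmx _ = ampl phi (fun a b => (a == b)%:R *: 1%:M - t *: B a b)).
    exact: phi_iso.
  by apply/matrixP=> i j; rewrite /ampl [LHS]mxE [RHS]mxE linearB !linearZ /= phi1.
split; apply: hform_ge0_transfer => t c t0 c0; by case: (iso t c c0).
Qed.

(* The form 2|u|^2 + 4 Re <R f, u> + 2K Q(f) >= 2|R f + u|^2, where R f is the sum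
   in the hypothesis, Q = hform (blockmx X) and |R f|^2 <= K Q(f), is that of a bordered block matrix over A. *)
Lemma kernel_relation_transfer k (X : 'I_k -> 'I_k -> 'M[C]_n)
    (Y Z : 'I_k -> 'M[C]_n) (eta : 'I_k -> 'cV[C]_m) :
  (forall a b, inToeplitz (X a b)) ->
  (forall b, inToeplitz (Y b)) -> (forall b, inToeplitz (Z b)) ->
  (forall v, 0 <= hform (blockmx X) v) ->
  (forall f, (blockmx X + adjmx (blockmx X)) *m glue f = 0 ->
     \sum_b (Y b + adjmx (Z b)) *m f b = 0) ->
  hform (ampl phi X) (glue eta) = 0 ->
  \sum_b (phi (Y b) + adjmx (phi (Z b))) *m eta b = 0.
Proof.
move=> XT YT ZT X0 kerX eta0.
pose R := block_row k n (fun b => Y b + adjmx (Z b)).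
have [v Hv|K K0 HK] := hform_kernel_bound _ _ _ R X0.
  by have [f vE] := glueP _ _ v; rewrite vE mul_block_row; apply: kerX; rewrite -vE.
pose B := bordered 1%:M (fun b => 2 *: Y b) (fun b => 2 *: Z b)
            (fun a b => (2 * K) *: X a b).
have c2 : (2 : C)^* = 2 by rewrite rmorph_nat.
have K2r : 2 * K \is Num.real by rewrite ger0_real ?mulr_ge0.
have sumW p (W1 W2 : 'I_k -> 'M[C]_p) (f : 'I_k -> 'cV[C]_p) :
    \sum_b (2 *: W1 b + adjmx (2 *: W2 b)) *m f b
    = 2 *: \sum_b (W1 b + adjmx (W2 b)) *m f b.
  rewrite scaler_sumr; apply: eq_bigr => b _.
  by rewrite adjmxZ c2 -scalerDr scalemxAl.
have BT a b : inToeplitz (B a b).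
  rewrite /B /bordered.
  by case: unlift => [a'|]; case: unlift => [b'|];
     by [apply: inToeplitz1 | apply: inToeplitzZ].
have B0 v : 0 <= hform (blockmx B) v.
  have [g ->] := glueP _ _ v.
  pose f b := g (lift ord0 b); set u := g ord0.
  rewrite (_ : glue g = glue (fun a => oapp f u (unlift ord0 a))); last first.
    by apply/colP=> i; rewrite !mxE; case: unliftP => [b|] ->.
  rewrite /B hform_bordered hform1 sumW.
  rewrite (_ : blockmx _ = (2 * K) *: blockmx X); last first.
    by apply/matrixP=> i j; rewrite !mxE.
  rewrite hformZ //; have := HK (glue f); rewrite mul_block_row.
  set r := \sum_b _ => le; rewrite -subr_ge0 in le.
  have := addr_ge0 le (vnorm2_ge0 _ (r + u)).
  rewrite vnorm2D -(pmulr_rge0 _ (ltr0Sn C 1)).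
  by apply: ge0_eq; rewrite ipZl rmorphM /= c2; ring.
have BT2 w : 0 <= hform (ampl phi B) w by move: w; apply/ampl_hform_ge0.
set r := \sum_b _.
(* With u = - r the form becomes 2 |r|^2 - 4 |r|^2, whose nonnegativity forces r = 0. *)
have := BT2 (glue (fun a => oapp eta (- r) (unlift ord0 a))).
have -> : ampl phi B = blockmx (bordered 1%:M (fun b => 2 *: phi (Y b))
    (fun b => 2 *: phi (Z b)) (fun a b => (2 * K) *: phi (X a b))).
  apply/matrixP=> i j; rewrite /ampl [LHS]mxE [RHS]mxE /B /bordered.
  by case: unlift => [a'|]; case: unlift => [b'|]; rewrite ?linearZ ?phi1.
rewrite hform_bordered hform1 sumW -/r.
rewrite (_ : blockmx _ = (2 * K) *: ampl phi X); last first.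
  by apply/matrixP=> i j; rewrite !mxE.
rewrite hformZ // eta0 mulr0 addr0 ipZl rmorphM /= c2 -[- r]scaleN1r vnorm2Z.
rewrite normrN1 expr1n mul1r ipZr rmorphN1 -vnorm2E rmorphM /= rmorphN1.
rewrite geC0_conj ?vnorm2_ge0 // => le.
apply: vnorm2_eq0; apply/eqP; rewrite eq_le vnorm2_ge0 andbT -oppr_ge0.
by rewrite -(pmulr_rge0 _ (ltr0Sn C 1)); apply: ge0_eq le; ring.
Qed.

(** Otherwise the image form is coercive; since positivity is also reflected by [phi], the form of X
    is then coercive too, against [xi]. *)
Lemma exists_kernel_vector k (X : 'I_k -> 'I_k -> 'M[C]_n) (xi : 'cV[C]_(k * n)) :
  (forall a b, inToeplitz (X a b)) ->
  (forall v, 0 <= hform (blockmx X) v) ->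
  xi != 0 -> hform (blockmx X) xi = 0 ->
  exists eta : 'I_k -> 'cV[C]_m,
    glue eta != 0 /\ hform (ampl phi X) (glue eta) = 0.
Proof.
move=> XT X0 xi0 Xxi; have /(ampl_hform_ge0 _ _ XT) pX0 := X0.
have [[v v0 Hv]|[K K0 HK]] := psd_kernel_or_coercive _ _ pX0.
  have [eta vE] := glueP _ _ v.
  by exists eta; rewrite -vE; split => //; apply: hform_ker.
have K2r : 2 * K \is Num.real by rewrite ger0_real ?mulr_ge0.
(* By coercivity 2 K X - 1 has a nonnegative image, the identity having form 2 |w|^2. *)
pose B a b := (2 * K) *: X a b - 1 *: ((a == b)%:R *: 1%:M).
have BT a b : inToeplitz (B a b).
  by apply: inToeplitzB; apply: inToeplitzZ => //; apply: inToeplitz1.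
have BE : blockmx B = (2 * K) *: blockmx X + (-1) *: 1%:M.
  by rewrite -blockmx1 scaleN1r; apply/matrixP=> i j; rewrite !mxE mul1r.
have pBE : ampl phi B = (2 * K) *: ampl phi X + (-1) *: 1%:M.
  rewrite -blockmx1 scaleN1r; apply/matrixP=> i j.
  by rewrite /ampl [LHS]mxE linearB !linearZ /= phi1 !mxE mul1r mulrN.
have /(ampl_hform_ge0 _ _ BT) pB0 : forall w, 0 <= hform (ampl phi B) w.
  move=> w; rewrite pBE hformD !hformZ ?realN // hform1 mulN1r -mulrA -mulrBr.
  by rewrite mulr_ge0 // subr_ge0.
have := pB0 xi; rewrite BE hformD !hformZ ?realN // Xxi mulr0 add0r hform1.
rewrite mulN1r oppr_ge0 pmulr_rle0 // => le.
case/eqP: xi0; apply: vnorm2_eq0; apply/eqP.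
by rewrite eq_le le vnorm2_ge0.
Qed.

End CompleteIsometry.

(** * The peaking block matrix *)

Arguments Spow : simpl never.

Section Chain.
Context {C : numClosedFieldType} {N : nat}.
Local Notation lo := (widen_ord (leqnSn N)).
Local Notation hi := (lift (@ord0 N)).
Local Notation S := (Spow C N.+1 1).

Lemma shift_entry (v : 'cV[C]_N.+1) c : (S *m v) (lo c) 0 = v (hi c) 0.
Proof.
rewrite mxE (bigD1 (hi c)) //= big1 ?addr0 => [|j jc].
  by rewrite SpowE addn1 lift0 eqxx mul1r.
by rewrite SpowE addn1 -(lift0 c) val_eqE (negPf jc) mul0r.
Qed.

Lemma shift_entry_max (v : 'cV[C]_N.+1) : (S *m v) ord_max 0 = 0.
Proof.
by rewrite mxE big1 // => j _; rewrite SpowE addn1 ltn_eqF ?mul0r // ltn_ord.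
Qed.

Lemma adj_shift_entry (v : 'cV[C]_N.+1) c : (adjmx S *m v) (hi c) 0 = v (lo c) 0.
Proof.
rewrite mxE (bigD1 (lo c)) //= big1 ?addr0 => [|j jc].
  by rewrite 2!mxE SpowE addn1 lift0 eqxx rmorph1 mul1r.
rewrite 2!mxE SpowE addn1 lift0 eqSS; case: eqP => [e|]; last by rewrite rmorph0 mul0r.
by case/eqP: jc; apply: val_inj.
Qed.

Lemma adj_shift_entry0 (v : 'cV[C]_N.+1) : (adjmx S *m v) ord0 0 = 0.
Proof. by rewrite mxE big1 // => j _; rewrite 2!mxE SpowE addn1 rmorph0 mul0r. Qed.

Lemma shift_mulmx_entry (A : 'M[C]_N.+1) c j : (S *m A) (lo c) j = A (hi c) j.
Proof.
by have := shift_entry (col j A) c; rewrite colE mulmxA -!colE mxE [RHS]mxE.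
Qed.

Lemma mulmx_shift_entry (A : 'M[C]_N.+1) i c : (A *m S) i (hi c) = A i (lo c).
Proof.
rewrite mxE (bigD1 (lo c)) //= big1 ?addr0 => [|j jc].
  by rewrite SpowE addn1 lift0 eqxx mulr1.
rewrite SpowE addn1 lift0 eqSS; case: eqP => [e|]; last by rewrite mulr0.
by case/eqP: jc; apply: val_inj.
Qed.

Lemma shift_mulmx_entry_max (A : 'M[C]_N.+1) j : (S *m A) ord_max j = 0.
Proof. by have := shift_entry_max (col j A); rewrite colE mulmxA -colE mxE. Qed.

Lemma mulmx_shift_entry0 (A : 'M[C]_N.+1) i : (A *m S) i ord0 = 0.
Proof. by rewrite mxE big1 // => j _; rewrite SpowE addn1 mulr0. Qed.

(** S discards the first entry and shifts the others. *)
Lemma vnorm2_shift (v : 'cV[C]_N.+1) : vnorm2 (S *m v) <= vnorm2 v.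
Proof.
rewrite /vnorm2 big_ord_recr [leRHS]big_ord_recl /= shift_entry_max normr0 expr0n addr0.
under eq_bigr do rewrite shift_entry.
by rewrite lerDr exprn_ge0.
Qed.

Lemma vnorm2_adj_shift (v : 'cV[C]_N.+1) : vnorm2 (adjmx S *m v) <= vnorm2 v.
Proof.
rewrite /vnorm2 big_ord_recl [leRHS]big_ord_recr /= adj_shift_entry0 normr0 expr0n add0r.
under eq_bigr do rewrite adj_shift_entry.
by rewrite lerDl exprn_ge0.
Qed.

(* Re <(chain) f, f> = sum_c |f_c|^2 + |f_(c+1)|^2 - 2 Re <S f_(c+1), f_c>. *)
Definition chain (a b : 'I_N.+1) : 'M[C]_N.+1 :=
  \sum_(c < N) (((a == lo c) && (b == lo c))%:R *: 1%:M
    + ((a == hi c) && (b == hi c))%:R *: 1%:M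
    + ((a == lo c) && (b == hi c))%:R *: ((-2) *: S)).

Lemma inToeplitz_chain a b : inToeplitz (chain a b).
Proof.
apply: inToeplitz_sum => c; apply: inToeplitzD; first apply: inToeplitzD.
- exact/inToeplitzZ/inToeplitz1.
- exact/inToeplitzZ/inToeplitz1.
- exact/inToeplitzZ/inToeplitzZ/inToeplitz_Spow.
Qed.

Lemma sum_ip_delta k n (Y : 'M[C]_n) (i j : 'I_k) f :
  \sum_a \sum_b ip ((((a == i) && (b == j))%:R *: Y) *m f b) (f a)
  = ip (Y *m f j) (f i).
Proof.
rewrite (bigD1 i) //= [X in _ + X]big1 ?addr0 => [|a /negPf ai]; last first.
  by rewrite big1 // => b _; rewrite ai scale0r mul0mx ip0l.
rewrite (bigD1 j) //= [X in _ + X]big1 ?addr0 => [|b /negPf bj]; last first.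
  by rewrite bj andbF scale0r mul0mx ip0l.
by rewrite !eqxx scale1r.
Qed.

(** Only the real part counts: the block -2 S at (c, c + 1) does the work of -S there and -S^* at (c
    + 1, c), and the blocks stay in A. *)
Lemma hform_chain f :
  hform (blockmx chain) (glue f)
  = \sum_(c < N) 2 * (vnorm2 (f (lo c)) + vnorm2 (f (hi c))
      - (ip (S *m f (hi c)) (f (lo c)) + (ip (S *m f (hi c)) (f (lo c)))^*)).
Proof.
have E : ip (blockmx chain *m glue f) (glue f)
   = \sum_(c < N) (vnorm2 (f (lo c)) + vnorm2 (f (hi c))
      - 2 * ip (S *m f (hi c)) (f (lo c))).
  rewrite ip_blockmx /chain.
  under eq_bigr do under eq_bigr do rewrite mulmx_suml ip_suml.
  under eq_bigr do rewrite exchange_big.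
  rewrite exchange_big; apply: eq_bigr => c _.
  under eq_bigr do under eq_bigr do rewrite !mulmxDl !ipDl.
  under eq_bigr do rewrite !big_split.
  rewrite !big_split /= !sum_ip_delta !mul1mx -scalemxAl ipZl !vnorm2E; ring.
rewrite /hform E rmorph_sum -big_split; apply: eq_bigr => c _ /=.
rewrite !rmorphD rmorphN rmorphM rmorph_nat /= !(geC0_conj (vnorm2_ge0 _ _)); ring.
Qed.

(** Completing the square in u. As S is a contraction, both summands are nonnegative, so a vanishing
    term forces u = S w. *)
Lemma chain_term_shift (u w : 'cV[C]_N.+1) :
  vnorm2 u + vnorm2 w - (ip (S *m w) u + (ip (S *m w) u)^*)
  = vnorm2 (u - S *m w) + (vnorm2 w - vnorm2 (S *m w)).
Proof.
rewrite -scaleN1r vnorm2D vnorm2Z normrN1 expr1n mul1r ipZr rmorphN1.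
rewrite rmorphM rmorphN1 /= !ip_conj; ring.
Qed.

(** Completing the square in w instead: a vanishing term also forces w = S^* u. *)
Lemma chain_term_adj_shift (u w : 'cV[C]_N.+1) :
  vnorm2 u + vnorm2 w - (ip (S *m w) u + (ip (S *m w) u)^*)
  = vnorm2 (w - adjmx S *m u) + (vnorm2 u - vnorm2 (adjmx S *m u)).
Proof.
rewrite -scaleN1r vnorm2D vnorm2Z normrN1 expr1n mul1r ipZr rmorphN1.
rewrite rmorphM rmorphN1 /= !ip_adjr; ring.
Qed.

Lemma chain_term_ge0 (u w : 'cV[C]_N.+1) :
  0 <= vnorm2 u + vnorm2 w - (ip (S *m w) u + (ip (S *m w) u)^*).
Proof.
by rewrite chain_term_shift addr_ge0 ?vnorm2_ge0 // subr_ge0 vnorm2_shift.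
Qed.

Lemma hform_chain_ge0 v : 0 <= hform (blockmx chain) v.
Proof.
have [f ->] := glueP _ _ v; rewrite hform_chain; apply: sumr_ge0 => c _.
by rewrite mulr_ge0 // chain_term_ge0.
Qed.

Lemma chain_term_eq0 (u w : 'cV[C]_N.+1) :
  vnorm2 u + vnorm2 w - (ip (S *m w) u + (ip (S *m w) u)^*) = 0 ->
  u = S *m w /\ w = adjmx S *m u.
Proof.
move=> e; split; apply/eqP; rewrite -subr_eq0; apply/eqP/vnorm2_eq0.
  move/eqP: e; rewrite chain_term_shift paddr_eq0 ?vnorm2_ge0 //.
    by case/andP=> /eqP.
  by rewrite subr_ge0 vnorm2_shift.
move/eqP: e; rewrite chain_term_adj_shift paddr_eq0 ?vnorm2_ge0 //.
  by case/andP=> /eqP.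
by rewrite subr_ge0 vnorm2_adj_shift.
Qed.

(** F is constant along diagonals; sliding an entry above the main diagonal down to the last column,
    or one below it up to the first column, shows that it is 0. *)
Lemma scalar_mx_shift (F : 'M[C]_N.+1) :
  (forall c d, F (lo c) (lo d) = F (hi c) (hi d)) ->
  (forall c, F (lo c) ord_max = 0) -> (forall c, F (hi c) ord0 = 0) ->
  F = (F ord0 ord0)%:M.
Proof.
move=> Fd Fr Fc.
(* Natural number indices let [GD] move along a diagonal by addition; [inord] is evaluated only up
   to N, within its range. *)
pose G i j := F (inord i) (inord j).
have GS i j : (i < N)%N -> (j < N)%N -> G i.+1 j.+1 = G i j.
  move=> iN jN; have := Fd (Ordinal iN) (Ordinal jN); rewrite /G.
  have -> : lo (Ordinal iN) = inord i by apply: val_inj; rewrite /= inordK // ltnW.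
  have -> : lo (Ordinal jN) = inord j by apply: val_inj; rewrite /= inordK // ltnW.
  have -> : hi (Ordinal iN) = inord i.+1 by apply: ord_inj; rewrite lift0 inordK.
  by have -> : hi (Ordinal jN) = inord j.+1 by apply: ord_inj; rewrite lift0 inordK.
have GD k i j : (i + k <= N)%N -> (j + k <= N)%N -> G (i + k)%N (j + k)%N = G i j.
  elim: k => [|k IH] in i j *; first by rewrite !addn0.
  by rewrite !addnS => iN jN; rewrite GS // IH // ltnW.
have G0 i : (i < N)%N -> G i.+1 0 = 0.
  move=> iN; have := Fc (Ordinal iN); rewrite /G.
  have -> : hi (Ordinal iN) = inord i.+1 by apply: ord_inj; rewrite lift0 inordK.
  by have -> : inord 0 = ord0 :> 'I_N.+1 by apply: val_inj; rewrite /= inordK.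
have GN i : (i < N)%N -> G i N = 0.
  move=> iN; have := Fr (Ordinal iN); rewrite /G.
  have -> : lo (Ordinal iN) = inord i by apply: val_inj; rewrite /= inordK // ltnW.
  by have -> : inord N = ord_max :> 'I_N.+1 by apply: val_inj; rewrite /= inordK.
apply/matrixP=> i j; rewrite mxE.
have -> : F i j = G i j by rewrite /G !inord_val.
have iN := leq_ord i; have jN := leq_ord j.
have [ij|ji|/ord_inj ->] := ltngtP i j.
- rewrite -val_eqE (ltn_eqF ij) mulr0n -(GD (N - j)%N) ?subnKC //; [|lia].
  by apply: GN; lia.
- rewrite -val_eqE (gtn_eqF ji) mulr0n.
  have := GD j (i - j)%N 0%N; rewrite subnK ?(ltnW ji) // add0n => -> //.
  by rewrite -(subnSK ji) G0 //; lia.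
rewrite eqxx mulr1n -[nat_of_ord j]add0n GD //.
by rewrite /G; congr (F _ _); apply: val_inj; rewrite /= inordK.
Qed.

(** A null vector satisfies f_c = S f_(c+1) and f_(c+1) = S^* f_c for all c. For the matrix with
    rows f_a, the first gives constant diagonals and zeros in the last column, the second gives
    zeros in the first column. *)
Lemma chain_ker f :
  (blockmx chain + adjmx (blockmx chain)) *m glue f = 0 ->
  exists s, forall a, f a = s *: delta_mx a 0.
Proof.
move/hform_ker; rewrite hform_chain => /eqP; rewrite psumr_eq0 => [|c _]; last first.
  by rewrite mulr_ge0 // chain_term_ge0.
move/allP=> e.
have {}e c : f (lo c) = S *m f (hi c) /\ f (hi c) = adjmx S *m f (lo c).
  apply: chain_term_eq0; apply/eqP; have := e c (mem_index_enum _).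
  by rewrite mulf_eq0 pnatr_eq0.
have Fs := scalar_mx_shift (\matrix_(a, i) f a i 0).
exists (f ord0 ord0 0) => a; apply/colP=> i.
have /matrixP/(_ a i) : \matrix_(a, i) f a i 0 = (f ord0 ord0 0)%:M.
  rewrite Fs ?mxE // => [c d|c|c]; rewrite !mxE.
  - by rewrite {1}(e c).1 shift_entry.
  - by rewrite (e c).1 shift_entry_max.
  - by rewrite (e c).2 adj_shift_entry0.
by rewrite !mxE eqxx andbT eq_sym mulr_natr.
Qed.

Lemma hform_chain_id : hform (blockmx chain) (glue (fun a => delta_mx a 0)) = 0.
Proof.
rewrite hform_chain big1 // => c _.
have -> : S *m delta_mx (hi c) 0 = delta_mx (lo c) 0 :> 'cV_N.+1.
  apply/colP=> i; rewrite -colE mxE SpowE lift0 addn1 eqSS eq_sym mxE eqxx andbT.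
  by rewrite -val_eqE.
rewrite -vnorm2E geC0_conj ?vnorm2_ge0 //.
have d (a : 'I_N.+1) : vnorm2 (delta_mx a 0 : 'cV[C]_N.+1) = 1.
  rewrite /vnorm2 (bigD1 a) //= big1 ?addr0 => [|i /negPf ia].
    by rewrite mxE !eqxx normr1 expr1n.
  by rewrite mxE ia normr0 expr0n.
by rewrite !d; ring.
Qed.

End Chain.

(** * The reducing subspace *)

Section ReducingSubspace.
Context {C : numClosedFieldType} (N m : nat) (phi : {linear 'M[C]_N.+1 -> 'M[C]_m}).
Hypothesis phi1 : phi 1%:M = 1%:M.
Hypothesis phi_iso : complete_isometry_on_A phi.

(** Writes the relation W f_b = sum_a D_a f_a with one block per f_a, the shape that
    [kernel_relation_transfer] takes. *)
Lemma sum_delta_sub k p (W : 'M[C]_p) (D : 'I_k -> C) (b : 'I_k) f :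
  \sum_a ((a == b)%:R *: W - D a *: 1%:M) *m f a
  = W *m f b - \sum_a D a *: f a :> 'cV_p.
Proof.
under eq_bigr do rewrite mulmxBl -!scalemxAl mul1mx.
rewrite sumrB; congr (_ - _); rewrite (bigD1 b) //= big1 ?addr0 ?eqxx ?scale1r //.
by move=> a /negPf ->; rewrite scale0r.
Qed.

Lemma sum_delta_sub_ker (W : 'M[C]_N.+1) b s (f : 'I_N.+1 -> 'cV[C]_N.+1) :
  (forall a, f a = s *: delta_mx a 0) ->
  \sum_a ((a == b)%:R *: W - W a b *: 1%:M) *m f a = 0.
Proof.
move=> fE; rewrite sum_delta_sub; apply/eqP; rewrite subr_eq0; apply/eqP/colP=> i.
rewrite fE -scalemxAr -colE summxE (bigD1 i) //= big1 ?addr0 => [|a /negPf ai].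
  by rewrite fE !mxE !eqxx /=; ring.
by rewrite fE !mxE eq_sym ai !mulr0.
Qed.

Lemma conj_real_nat (b : bool) : (b%:R : C)^* = b%:R.
Proof. exact: rmorph_nat. Qed.

(** The standard basis, the null vector of the chain up to scalars, satisfies X e_b = sum_a X_ab e_a
    and the analogue for X^*. These relations pass to a null vector [eta] of the image, whose blocks
    are the columns of V; the first enters through Y, the second through Z. *)
Lemma exists_intertwiner : exists V : 'M[C]_(m, N.+1), V != 0 /\
  forall X, inToeplitz X ->
    phi X *m V = V *m X /\ adjmx (phi X) *m V = V *m adjmx X.
Proof.
pose xi : 'cV[C]_(N.+1 * N.+1) := glue (fun a => delta_mx a 0).
have xi0 : xi != 0.
  apply/negP=> /eqP/colP/(_ (mxvec_index ord0 ord0)).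
  by rewrite !mxE mxvec_indexK !eqxx => /eqP; rewrite oner_eq0.
have [eta [eta0 etaX]] := exists_kernel_vector _ _ _ phi1 phi_iso _ _ _
  inToeplitz_chain hform_chain_ge0 xi0 hform_chain_id.
have rel Y Z YT ZT kYZ := kernel_relation_transfer _ _ _ phi1 phi_iso _ _ Y Z eta
  inToeplitz_chain YT ZT hform_chain_ge0 kYZ etaX.
exists (\matrix_(i, b) eta b i 0); split.
  apply: contra_neq eta0 => V0; apply/colP=> i; rewrite !mxE.
  by move/matrixP/(_ (bidx i).2 (bidx i).1): V0; rewrite !mxE.
set V := \matrix_(i, b) _ => X XT.
have VE (W : 'M_m) (D : 'M_N.+1) :
    (forall b, W *m eta b - \sum_a D a b *: eta a = 0) -> W *m V = V *m D.
  move=> WD; apply/matrixP=> i b.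
  have /eqP := WD b; rewrite subr_eq0 => /eqP/colP/(_ i).
  rewrite summxE !mxE => E.
  transitivity (\sum_j W i j * eta b j 0); first by apply: eq_bigr => j _; rewrite mxE.
  by rewrite E; apply: eq_bigr => j _; rewrite !mxE mulrC.
have XbT a b : inToeplitz ((a == b)%:R *: X - X a b *: 1%:M).
  by apply: inToeplitzB; [apply: inToeplitzZ | apply: inToeplitz1].
(* The indices of the coefficient are swapped because the adjoint of this block must carry the
   conjugate of X_ba, which is the (a, b) entry of X^*. *)
have XbT' a b : inToeplitz ((a == b)%:R *: X - X b a *: 1%:M).
  by apply: inToeplitzB; [apply: inToeplitzZ | apply: inToeplitz1].
have phiE c d : phi (c *: X - d *: 1%:M) = c *: phi X - d *: 1%:M.
  by rewrite linearB !linearZ /= phi1 scalerN.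
split; apply: VE => b; rewrite -sum_delta_sub.
- rewrite -[RHS](rel (fun a => (a == b)%:R *: X - X a b *: 1%:M) (fun=> 0)) //.
  + by apply: eq_bigr => a _; rewrite linear0 adjmx0 addr0 phiE.
  + by move=> _; apply: inToeplitz0.
  move=> f /chain_ker[s fE]; under eq_bigr do rewrite adjmx0 addr0.
  exact: sum_delta_sub_ker fE.
have adjE p (W : 'M[C]_p) a : adjmx ((a == b)%:R *: W - X b a *: 1%:M)
    = (a == b)%:R *: adjmx W - (adjmx X) a b *: 1%:M.
  by rewrite -scaleNr adjmxD !adjmxZ adjmx1 rmorphN scaleNr conj_real_nat !mxE.
rewrite -[RHS](rel (fun=> 0) (fun a => (a == b)%:R *: X - X b a *: 1%:M)) //.
- by apply: eq_bigr => a _; rewrite linear0 add0r phiE adjE.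
- by move=> _; apply: inToeplitz0.
move=> f /chain_ker[s fE]; under eq_bigr do rewrite add0r adjE.
exact: sum_delta_sub_ker fE.
Qed.

(** Both relations together give V^* V X = V^* phi(X) V = X V^* V. Hence V^* V is a positive scalar
    s, and dividing V by the square root of s makes it an isometry. *)
Lemma exists_isometric_intertwiner : exists V : 'M[C]_(m, N.+1),
  adjmx V *m V = 1%:M /\
  forall X, inToeplitz X ->
    phi X *m V = V *m X /\ adjmx (phi X) *m V = V *m adjmx X.
Proof.
have [V [V0 VT]] := exists_intertwiner.
set G := adjmx V *m V.
have GX X : inToeplitz X -> G *m X = X *m G.
  move=> /VT[VX VX']; rewrite /G -mulmxA -VX.
  rewrite mulmxA -[adjmx V *m phi X]adjmxK adjmxM adjmxK VX' adjmxM adjmxK.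
  by rewrite mulmxA.
have GG : adjmx G = G by rewrite /G adjmxM adjmxK.
have /matrixP GS := GX _ (inToeplitz_Spow N.+1 1).
have G_hi0 c : G (lift ord0 c) ord0 = 0.
  by rewrite -shift_mulmx_entry -GS mulmx_shift_entry0.
have Gs : G = (G ord0 ord0)%:M.
  (* Commuting with S clears the first column and the last row off the diagonal; self-adjointness
     turns the last row into the last column. *)
  apply: scalar_mx_shift => // [c d|c].
    by rewrite -[RHS]shift_mulmx_entry -GS mulmx_shift_entry.
  have GE a b : G a b = (G b a)^* by rewrite -[in LHS]GG !mxE.
  by rewrite GE -mulmx_shift_entry GS shift_mulmx_entry_max rmorph0.
set s := G ord0 ord0 in Gs.
have s0 : 0 <= s.
  rewrite /s mxE; apply: sumr_ge0 => i _.
  by rewrite !mxE mulrC -normCK exprn_ge0.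
have sn0 : s != 0.
  apply: contra_neq V0 => se; apply/matrixP=> i b; rewrite mxE.
  have : vnorm2 (V *m delta_mx b 0) = 0.
    rewrite vnorm2E ip_adjr mulmxA -/G Gs se -scalemx1 scale0r mul0mx.
    by rewrite ip0r.
  by move/vnorm2_eq0/colP/(_ i); rewrite -colE !mxE.
exists ((sqrtC s)^-1 *: V); split.
  have rc : ((sqrtC s)^-1)^* = (sqrtC s)^-1.
    by apply: geC0_conj; rewrite invr_ge0 sqrtC_ge0.
  rewrite adjmxZ rc -scalemxAl -scalemxAr -/G Gs -scalemx1 !scalerA.
  rewrite -invfM -expr2 sqrtCK mulVf //.
  by rewrite scale1r.
by move=> X /VT[VX VX']; rewrite -!scalemxAr -!scalemxAl VX VX'.
Qed.

End ReducingSubspace.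

(** * Decomposition along the reducing subspace *)

Section Decomposition.
Context {C : numClosedFieldType}.

Lemma mulmx1_eqC (m k : nat) (A : 'M[C]_(m, k)) (B : 'M[C]_(k, m)) :
  k = m -> B *m A = 1%:M -> A *m B = 1%:M.
Proof. by move=> e; case: _ / e A B => A B; apply: mulmx1C. Qed.

(** The rows of W^* are an orthonormal basis, by Gram-Schmidt, of the row vectors annihilating V. A
    rank count makes [V W] square, so being an isometry it is unitary. *)
Lemma isometry_complement m k (V : 'M[C]_(m, k)) : adjmx V *m V = 1%:M ->
  exists p (W : 'M[C]_(m, p)), [/\ (k + p)%N = m,
    adjmx W *m W = 1%:M, adjmx V *m W = 0 & V *m adjmx V + W *m adjmx W = 1%:M].
Proof.
move=> VV; set S := schmidt (row_base (kermx V)).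
have SS : S *m adjmx S = 1%:M.
  have /unitarymxP := schmidt_unitarymx (row_base (kermx V)) (rank_leq_col _).
  by rewrite -map_trmx.
have SV : S *m V = 0.
  by apply/sub_kermxP; rewrite eqmx_schmidt_free ?row_base_free // eq_row_base.
have rV : \rank V = k.
  apply/eqP; rewrite eqn_leq rank_leq_col -{1}(mxrank1 C k) -VV mxrankM_maxr //.
have km : (k + \rank (kermx V))%N = m.
  by rewrite mxrank_ker rV subnKC // -rV rank_leq_row.
have VS : adjmx V *m adjmx S = 0 by rewrite -adjmxM SV adjmx0.
exists (\rank (kermx V)), (adjmx S); split => //; first by rewrite adjmxK.
rewrite adjmxK -mul_row_col; apply: mulmx1_eqC => //.
by rewrite mul_col_row VV VS SV SS -scalar_mx_block.
Qed.

(* The unitary identification of C^(1 * n) with C^n: the two types differ. *)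
Definition unfold1 n : 'M[C]_(n, 1 * n) := \matrix_(i, j) (i == (bidx j).2)%:R.

Lemma unfold1_entry q n (X : 'M[C]_(q, n)) i j : (X *m unfold1 n) i j = X i (bidx j).2.
Proof.
rewrite mxE (bigD1 (bidx j).2) //= big1 ?addr0 => [|k /negPf kj].
  by rewrite mxE eqxx mulr1.
by rewrite mxE kj mulr0.
Qed.

Lemma copies1E n (X : 'M[C]_n) i j : copies 1 X i j = X (bidx i).2 (bidx j).2.
Proof. by rewrite mxE !ord1 eqxx. Qed.

Lemma adj_copies1 n (X : 'M[C]_n) : adjmx (copies 1 X) = copies 1 (adjmx X).
Proof. by apply/matrixP=> i j; rewrite copies1E 2!mxE copies1E !mxE. Qed.

Lemma unfold1_copies n (X : 'M[C]_n) : unfold1 n *m copies 1 X = X *m unfold1 n.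
Proof.
apply/matrixP=> i j; rewrite unfold1_entry mxE.
transitivity (\sum_(a < 1) \sum_b (i == b)%:R * X b (bidx j).2).
  rewrite -(sum_bidx _ _ _ (fun a b => (i == b)%:R * X b (bidx j).2)).
  by apply: eq_bigr => k _; rewrite mxE copies1E.
rewrite big_ord1 (bigD1 i) //= big1 ?addr0 => [|b bi]; first by rewrite eqxx mul1r.
by rewrite eq_sym (negPf bi) mul0r.
Qed.

Lemma adj_unfold1K n : adjmx (unfold1 n) *m unfold1 n = 1%:M.
Proof.
apply/matrixP=> i j; rewrite unfold1_entry !mxE rmorph_nat eq_sym.
congr (nat_of_bool _)%:R.
rewrite -(can_eq (bidxK 1 n)) [bidx i]surjective_pairing [bidx j]surjective_pairing.
by rewrite xpair_eqE !ord1 eqxx.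
Qed.

(** W is an isometry on each block and W^* a contraction. *)
Lemma compression_contractive n m p (phi : 'M[C]_n -> 'M[C]_m) (W : 'M[C]_(m, p)) :
  adjmx W *m W = 1%:M -> complete_isometry_on_A phi ->
  complete_contraction_on_A (fun X => adjmx W *m phi X *m W).
Proof.
move=> WW iso k B BT c c0 /(iso _ _ BT _ c0) Bc v.
have [f ->] := glueP _ _ v.
have := Bc (glue (fun b => W *m f b)).
rewrite /ampl !mul_blockmx !vnorm2_glue.
under [X in _ <= _ * X -> _]eq_bigr do rewrite vnorm2_isometry //.
apply: le_trans; apply: ler_sum => a _.
apply: le_trans (vnorm2_coisometry _ _ _ _ WW); rewrite mulmx_sumr le_eqVlt.
by apply/orP; left; apply/eqP; congr vnorm2; apply: eq_bigr => b _; rewrite !mulmxA.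
Qed.

(** The two relations say that the range of V reduces phi(A): with respect to [V W] both
    off-diagonal corners of phi(X) vanish. The corner on V is X, a single copy, and the corner on W
    defines [psi]. *)
Lemma decomposition_of_reducing n m (phi : {linear 'M[C]_n -> 'M[C]_m})
    (V : 'M[C]_(m, n)) :
  phi 1%:M = 1%:M -> complete_isometry_on_A phi -> adjmx V *m V = 1%:M ->
  (forall X, inToeplitz X ->
     phi X *m V = V *m X /\ adjmx (phi X) *m V = V *m adjmx X) ->
  (n <= m)%N /\
  exists (l p : nat), (0 < l)%N /\ (l * n + p)%N = m /\
    exists (U : 'M[C]_(m, l * n + p)) (psi : {linear 'M[C]_n -> 'M[C]_p}),
      U *m adjmx U = 1%:M /\ adjmx U *m U = 1%:M /\
      psi 1%:M = 1%:M /\ complete_contraction_on_A psi /\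
      forall X : 'M[C]_n, inToeplitz X ->
        phi X = U *m block_mx (copies l X) 0 0 (psi X) *m adjmx U.
Proof.
move=> phi1 iso VV VX; split; first exact: mulmx1_min VV.
pose V' := V *m unfold1 n.
have VV' : adjmx V' *m V' = 1%:M.
  by rewrite adjmxM -mulmxA (mulmxA _ V) VV mul1mx adj_unfold1K.
have [p [W [kp WW VW res]]] := isometry_complement _ _ _ VV'.
have WV : adjmx W *m V' = 0 by rewrite -[LHS]adjmxK adjmxM adjmxK VW adjmx0.
exists 1%N, p; split=> //; split=> //.
exists (row_mx V' W), (mulmxr W \o mulmx (adjmx W) \o phi).
have adjU : adjmx (row_mx V' W) = col_mx (adjmx V') (adjmx W).
  by rewrite /adjmx map_row_mx tr_row_mx.
rewrite adjU; split; first by rewrite mul_row_col.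
split; first by rewrite mul_col_row VV' VW WV WW -scalar_mx_block.
split; first by rewrite /= phi1 mulmx1.
split; first exact: compression_contractive.
move=> X /VX[pV pV'].
have PV : phi X *m V' = V' *m copies 1 X.
  by rewrite /V' mulmxA pV -!mulmxA unfold1_copies.
have VP : adjmx V' *m phi X *m W = 0.
  (* The adjoint of the relation for phi(X)^*. *)
  have -> : adjmx V' *m phi X = copies 1 X *m adjmx V'.
    apply: (can_inj (@adjmxK C _ _)).
    rewrite ![adjmx (_ *m phi X)]adjmxM ![adjmx (copies 1 X *m _)]adjmxM.
    rewrite !adjmxK adj_copies1 /V' mulmxA pV'.
    by rewrite -!mulmxA unfold1_copies.
  by rewrite -mulmxA VW mulmx0.
rewrite mul_row_block !mulmx0 addr0 add0r mul_row_col /=.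
(* Inserting V' V'^* + W W^* = 1 on the right, and then on the left of the W term, leaves only the
   two diagonal corners. *)
rewrite -[LHS]mulmx1 -res mulmxDr (mulmxA (phi X) V') PV (mulmxA (phi X) W).
congr (_ + _ *m _).
rewrite -[LHS]mul1mx -res mulmxDl -(mulmxA V') (mulmxA (adjmx V')) VP mulmx0 add0r.
by rewrite !mulmxA.
Qed.

End Decomposition.

Theorem theorem6p2 (C : numClosedFieldType) (n m : nat)
    (phi : {linear 'M[C]_n -> 'M[C]_m}) :
  phi 1%:M = 1%:M ->
  complete_isometry_on_A phi ->
  (n <= m)%N /\
  exists (l p : nat), (0 < l)%N /\ (l * n + p)%N = m /\
    exists (U : 'M[C]_(m, l * n + p)) (psi : {linear 'M[C]_n -> 'M[C]_p}),
      U *m adjmx U = 1%:M /\ adjmx U *m U = 1%:M /\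
      psi 1%:M = 1%:M /\ complete_contraction_on_A psi /\
      forall X : 'M[C]_n, inToeplitz X ->
        phi X = U *m block_mx (copies l X) 0 0 (psi X) *m adjmx U.
Proof.
case: n phi => [|N] phi phi1 iso.
  (* The chain requires n > 0; for n = 0 the empty V meets all the requirements. *)
  apply: (decomposition_of_reducing _ _ _ 0) => //.
    by rewrite [LHS]thinmx0 [RHS]thinmx0.
  by move=> X _; split; rewrite [LHS]thinmx0 [RHS]thinmx0.
have [V [VV VX]] := exists_isometric_intertwiner _ _ _ phi1 iso.
exact: decomposition_of_reducing VX.
Qed.
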